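(* (i) $N_1$ is multiplicatively piecewise syndetic but not additively piecewise syndetic. (ii) $N_1$ is an additive $IP_0$ set and a multiplicative $IP$ set, but not an additive $IP$ set. (iii) There do not exist $x,y\in\mathbb{N}$ such that $x+y\in\mathcal{X}$ and $xy\in\mathcal{X}$. (iv) $N_1$ contains arbitrarily long arithmetic progressions and arbitrarily long geometric progressions.
   Context: $\phi$ is Euler's totient function, $V$ its image; for $m\in V$, $N_1(m)=\max\{x\in\mathbb{N}:\phi(x)\le m\}$, $N_1=\{N_1(m):m\in V\}$. For $n\in\mathbb{N}$ and a prime $p$, $X_{n,p}=\left(n\prod_{q\mid n}q^{-1}\right)\prod_{q\le p}q$ (products over primes $q$), and $\mathcal{X}=\{X_{n,p}: n\in\mathbb{N},\ p \text{ prime},\ p>n/2\}$. For a commutative semigroup $(G,* )$ (here $(\mathbb{N},+)$ or $(\mathbb{N},\cdot)$) and $A\subset G$: $A$ is thick if for every finite nonempty $F\subset G$ there is $x\in G$ with $F*x\subset A$; $A$ is piecewise syndetic if there is a finite nonempty $S\subset G$ such that $\bigcup_{t\in S}t^{-1}A$ is thick, where $t^{-1}A=\{x\in G: t*x\in A\}$ (for addition, $-t+A$). Additively/multiplicatively refers to the operation used. For a sequence $x=(x_n)_{n\in J}$, $FS(x)=\{\sum_{n\in F}x_n: F\subset J \text{ finite nonempty}\}$, $FP(x)=\{\prod_{n\in F}x_n: F\subset J\text{ finite nonempty}\}$. $A\subset\mathbb{N}$ is an additive (multiplicative) $IP_r$ set if $FS(x)\subset A$ ($FP(x)\subset A$)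 for some sequence indexed by a set $J$ with $|J|=r$; an additive (multiplicative) $IP_0$ set if it is an additive (multiplicative) $IP_r$ set for every $r\in\mathbb{N}$; an additive (multiplicative) $IP$ set if $FS(x)\subset A$ ($FP(x)\subset A$) for some infinite sequence $x=(x_n)_{n\in\mathbb{N}}$. *)

(* Defs.v *)
From mathcomp Require Import all_boot.

Set Implicit Arguments.
Unset Strict Implicit.
Unset Printing Implicit Defensive.

(* Throughout, the natural numbers of the mathematics start at 1.  They are
   rendered as the elements of [nat] satisfying [0 < x], so every quantifier
   over them carries this guard; subsets are predicates on [nat]. *)

Definition totient_image (m : nat) : Prop :=
  exists2 x, 0 < x & totient x = m.

(* [is_N1 m x]: x is the maximum N_1(m) of the set {y >= 1 : totient y <= m}. *)
Definition is_N1 (m x : nat) : Prop :=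
  [/\ 0 < x, totient x <= m
    & forall y, 0 < y -> totient y <= m -> y <= x].

Definition N1 (x : nat) : Prop := exists2 m, totient_image m & is_N1 m x.

(* The division is exact: the product of the prime divisors of n divides n. *)
Definition X_ (n p : nat) : nat :=
  (n %/ \prod_(q <- primes n) q) * \prod_(q < p.+1 | prime q) q.

(* [n < 2 * p] is the rational inequality n / 2 < p. *)
Definition calX (x : nat) : Prop :=
  exists n p, [/\ 0 < n, prime p, n < 2 * p & x = X_ n p].

Section Semigroup.

(* The operation of the semigroup of positive integers: [addn] or [muln]. *)
Variable op : nat -> nat -> nat.

Definition thick (A : nat -> Prop) : Prop :=
  forall F : seq nat, F != [::] -> {in F, forall f, 0 < f} ->
  exists2 x, 0 < x & {in F, forall f, A (op f x)}.

Definition translate_inv (t : nat) (A : nat -> Prop) (x : nat) : Prop :=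
  0 < x /\ A (op t x).

Definition piecewise_syndetic (A : nat -> Prop) : Prop :=
  exists S : seq nat,
    [/\ S != [::], {in S, forall t, 0 < t}
      & thick (fun x => exists2 t, t \in S & translate_inv t A x)].

End Semigroup.

(* Finite nonempty subsets of the index type J are represented by nonempty
   duplicate-free sequences. *)
Definition FS (J : eqType) (x : J -> nat) (s : nat) : Prop :=
  exists F : seq J, [/\ F != [::], uniq F & s = \sum_(j <- F) x j].

Definition FP (J : eqType) (x : J -> nat) (s : nat) : Prop :=
  exists F : seq J, [/\ F != [::], uniq F & s = \prod_(j <- F) x j].

Definition additive_IPr (r : nat) (A : nat -> Prop) : Prop :=
  exists2 x : 'I_r -> nat, (forall j, 0 < x j) & forall s, FS x s -> A s.

Definition multiplicative_IPr (r : nat) (A : nat -> Prop) : Prop :=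
  exists2 x : 'I_r -> nat, (forall j, 0 < x j) & forall s, FP x s -> A s.

Definition additive_IP0 (A : nat -> Prop) : Prop :=
  forall r, 0 < r -> additive_IPr r A.

Definition multiplicative_IP0 (A : nat -> Prop) : Prop :=
  forall r, 0 < r -> multiplicative_IPr r A.

Definition additive_IP (A : nat -> Prop) : Prop :=
  exists2 x : nat -> nat, (forall j, 0 < x j) & forall s, FS x s -> A s.

Definition multiplicative_IP (A : nat -> Prop) : Prop :=
  exists2 x : nat -> nat, (forall j, 0 < x j) & forall s, FP x s -> A s.

Definition contains_arbitrarily_long_AP (A : nat -> Prop) : Prop :=
  forall k, exists a d,
    [/\ 0 < a, 0 < d & forall i, i < k -> A (a + i * d)].

Definition contains_arbitrarily_long_GP (A : nat -> Prop) : Prop :=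
  forall k, exists a r,
    [/\ 0 < a, 1 < r & forall i, i < k -> A (a * r ^ i)].

(* Main.v *)
(** Let P(p) be the product of the primes up to p. If y has no more primes above
    p than it misses below p, then y / phi(y) <= P(p) / phi(P(p)); otherwise
    phi(y) >= p phi(P(p)). Hence k P(p) is in N_1 whenever 0 < k < p, which gives
    multiplicative thickness (hence the multiplicative IP property), additive IP_r
    structure and both kinds of progressions.

    Conversely, if a prime q does not divide n in N_1, exchanging a divisor d of n
    for the least larger multiple of q must increase phi; taking for d a prime or a
    repeated prime power bounds n in terms of q. So every prime divides all large
    elements of N_1, which excludes the additive properties.

    Elements of calX have the form k P(p) with 0 < k < p. If x + y = k P(p) and
    x y = l P(r), the primes up to min(p, r) divide both x and y: for r <= p this
    forces P(r) | l < r, and for p < r the prime r divides x / P(p) or y / P(p),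
    both of which are less than k. *)

Require Import Defs.
From mathcomp Require Import all_boot.
From mathcomp Require Import zify.

(** * Totients and products of primes *)

Lemma totient_mul_prime_dvd (p n : nat) :
  prime p -> 0 < n -> p %| n -> totient (p * n) = p * totient n.
Proof.
move=> pr_p n_gt0 p_n; have p_gt0 := prime_gt0 pr_p.
have e_gt0 : 0 < logn p n by rewrite -pfactor_dvdn ?expn1.
have [m co_pm def_n] := pfactor_coprime pr_p n_gt0.
move: e_gt0 def_n; case: (logn p n) => // e _ ->.
have co k : coprime m (p ^ k) by rewrite coprime_sym coprimeXl.
rewrite mulnCA -expnS !(totient_coprime (co _)) !totient_pfactor //= expnS; lia.
Qed.

Lemma totient_mul_prime_ndvd (p n : nat) :
  prime p -> ~~ (p %| n) -> totient (p * n) = p.-1 * totient n.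
Proof.
by move=> pr_p p_n; rewrite totient_coprime ?prime_coprime // totient_prime.
Qed.

Lemma leq_totient_mul_prime (p n : nat) :
  prime p -> 0 < n -> p.-1 * totient n <= totient (p * n).
Proof.
move=> pr_p n_gt0; have [p_n|p_n] := boolP (p %| n).
  by rewrite totient_mul_prime_dvd // leq_mul2r leq_pred orbT.
by rewrite totient_mul_prime_ndvd.
Qed.

(** Each prime factor [p] of [m], peeled off by strong induction, multiplies the totient by [p] or
    [p.-1]. *)
Lemma totient_mul_leq (m n : nat) : 0 < n -> totient (m * n) <= m * totient n.
Proof.
elim/ltn_ind: m n => m IHm n n_gt0.
have [m_le1|m_gt1] := leqP m 1; first by case: m m_le1 {IHm} => [|[]] // _; rewrite ?mul1n.
have pr_p := pdiv_prime m_gt1; set p := pdiv m in pr_p.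
have p_gt1 := prime_gt1 pr_p.
have def_m : m = m %/ p * p by rewrite divnK ?pdiv_dvd.
have lt_m : m %/ p < m by rewrite ltn_Pdiv // ltnW.
rewrite {1}def_m -mulnA; apply: leq_trans (IHm _ lt_m _ _) _.
  by rewrite muln_gt0 n_gt0 ltnW.
rewrite [X in _ <= X * _]def_m -mulnA leq_mul2l; apply/orP; right.
have [p_n|p_n] := boolP (p %| n); first by rewrite totient_mul_prime_dvd.
by rewrite totient_mul_prime_ndvd // leq_mul2r leq_pred orbT.
Qed.

Lemma totient_mul_expn (p n j : nat) :
  prime p -> 0 < n -> p %| n -> totient (p ^ j * n) = p ^ j * totient n.
Proof.
move=> pr_p n_gt0 p_n; elim: j => [|j IHj]; first by rewrite !mul1n.
rewrite expnS -mulnA totient_mul_prime_dvd ?dvdn_mull // ?IHj ?mulnA //.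
by rewrite muln_gt0 expn_gt0 prime_gt0.
Qed.

Lemma coprime_prod_primes (p : nat) (s : seq nat) :
  prime p -> all prime s -> p \notin s -> coprime p (\prod_(q <- s) q).
Proof.
move=> pr_p; elim: s => [|q s IHs] /=; first by rewrite big_nil coprimen1.
case/andP=> pr_q pr_s; rewrite inE negb_or => /andP[ne_pq p_s].
by rewrite big_cons coprimeMr IHs // prime_coprime // dvdn_prime2 ?ne_pq.
Qed.

Lemma totient_prod_primes (s : seq nat) :
  uniq s -> all prime s -> totient (\prod_(q <- s) q) = \prod_(q <- s) q.-1.
Proof.
elim: s => [|q s IHs] /=; first by rewrite !big_nil.
case/andP=> q_s uniq_s /andP[pr_q pr_s].
rewrite !big_cons totient_coprime; last exact: coprime_prod_primes.
by rewrite totient_prime ?IHs.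
Qed.

Lemma prod_primes_dvd (s : seq nat) (n : nat) :
  uniq s -> all prime s -> {in s, forall q, q %| n} -> \prod_(q <- s) q %| n.
Proof.
elim: s => [|q s IHs] /=; first by rewrite big_nil dvd1n.
case/andP=> q_s uniq_s /andP[pr_q pr_s] dvd_s.
rewrite big_cons Gauss_dvd ?coprime_prod_primes //.
rewrite dvd_s ?mem_head // IHs // => x x_s.
by rewrite dvd_s // inE x_s orbT.
Qed.

Lemma prod_primes_logn (n : nat) :
  0 < n -> n = \prod_(p <- primes n) p ^ logn p n.
Proof. by move=> n_gt0; rewrite {1}(prod_prime_decomp n_gt0) prime_decompE big_map. Qed.

(** The exponents are those of [totientE], so [n] and [totient n] share the first product as a
    common factor. *)
Lemma radical_cofactor (n : nat) :
  0 < n -> n = (\prod_(p <- primes n) p ^ (logn p n).-1) * \prod_(p <- primes n) p.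
Proof.
move=> n_gt0; rewrite {1}(prod_primes_logn _ n_gt0) -big_split /=.
rewrite big_seq [RHS]big_seq; apply: eq_bigr => p.
by rewrite -logn_gt0 -expnSr; case: (logn p n).
Qed.

Lemma prod_gt0_seq (s : seq nat) (F : nat -> nat) :
  {in s, forall q, 0 < F q} -> 0 < \prod_(q <- s) F q.
Proof. by move=> F_gt0; rewrite big_seq; apply: prodn_cond_gt0. Qed.

Lemma leq_prod_seq (s : seq nat) (F G : nat -> nat) :
  {in s, forall q, F q <= G q} -> \prod_(q <- s) F q <= \prod_(q <- s) G q.
Proof. by move=> le_FG; rewrite big_seq [leqRHS]big_seq; apply: leq_prod. Qed.

Lemma prod_const_seq (s : seq nat) (a : nat) : \prod_(q <- s) a = a ^ size s.
Proof. by rewrite big_const_seq count_predT iter_muln_1. Qed.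

Lemma leq_max_seq (s : seq nat) (n : nat) : n \in s -> n <= \max_(i <- s) i.
Proof. by move=> n_s; apply: (leq_bigmax_seq (F := id)). Qed.

Lemma max_seq_mem (s : seq nat) : s != [::] -> \max_(i <- s) i \in s.
Proof.
elim: s => // i [|j s] IHs _; first by rewrite big_seq1 mem_head.
rewrite big_cons inE /maxn; case: ifP => _; last by rewrite eqxx.
by rewrite IHs ?orbT.
Qed.

Lemma mul_prod_seq (s : seq nat) (F : nat -> nat) (a : nat) :
  \prod_(q <- s) (F q * a) = (\prod_(q <- s) F q) * a ^ size s.
Proof. by rewrite big_split /= prod_const_seq. Qed.

(** * Primorials *)

Definition primes_upto (p : nat) : seq nat := [seq q <- iota 0 p.+1 | prime q].

Definition primorial (p : nat) : nat := \prod_(q <- primes_upto p) q.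

Lemma mem_primes_upto (p q : nat) : (q \in primes_upto p) = prime q && (q <= p).
Proof. by rewrite mem_filter mem_iota. Qed.

Lemma primes_upto_uniq (p : nat) : uniq (primes_upto p).
Proof. by rewrite filter_uniq ?iota_uniq. Qed.

Lemma primes_upto_prime (p : nat) : all prime (primes_upto p).
Proof. exact: filter_all. Qed.

Lemma primorialE (p : nat) : \prod_(q < p.+1 | prime q) q = primorial p.
Proof. by rewrite /primorial big_filter -(big_mkord prime id). Qed.

Lemma primorial_gt0 (p : nat) : 0 < primorial p.
Proof. by apply: prod_gt0_seq => q; rewrite mem_primes_upto => /andP[/prime_gt0]. Qed.

Lemma prime_dvd_primorial (q p : nat) : prime q -> (q %| primorial p) = (q <= p).
Proof.
move=> pr_q; apply/idP/idP => [|le_qp].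
  apply: contraTT => lt_pq; rewrite -prime_coprime // coprime_prod_primes //.
    exact: primes_upto_prime.
  by rewrite mem_primes_upto pr_q.
rewrite /primorial (big_rem q) ?dvdn_mulr //=.
by rewrite mem_primes_upto pr_q.
Qed.

Lemma primorial_dvd (p n : nat) :
  (forall q, prime q -> q <= p -> q %| n) -> primorial p %| n.
Proof.
move=> dvd_n; apply: prod_primes_dvd.
- exact: primes_upto_uniq.
- exact: primes_upto_prime.
by move=> q; rewrite mem_primes_upto => /andP[]; apply: dvd_n.
Qed.

Lemma totient_primorial (p : nat) :
  totient (primorial p) = \prod_(q <- primes_upto p) q.-1.
Proof. by rewrite totient_prod_primes ?primes_upto_uniq ?primes_upto_prime. Qed.

(* Here [B] collects the primes of [y] above [p] and [C] the primes up to [p]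
   missing from [y]; all ratios [q / (q - 1)] are compared with [(p + 1) / p]. *)
Lemma prod_ratio_exchange (p : nat) (B C : seq nat) :
  0 < p -> {in B, forall q, p < q} -> {in C, forall q, 0 < q <= p} ->
  size B <= size C ->
  (\prod_(q <- B) q) * \prod_(q <- C) q.-1
    <= (\prod_(q <- C) q) * \prod_(q <- B) q.-1.
Proof.
move=> p_gt0 B_gt C_le szBC.
have leB : (\prod_(q <- B) q) * p ^ size B <= (\prod_(q <- B) q.-1) * p.+1 ^ size B.
  by rewrite -!mul_prod_seq; apply: leq_prod_seq => q /B_gt; nia.
have leC : (\prod_(q <- C) q.-1) * p.+1 ^ size C <= (\prod_(q <- C) q) * p ^ size C.
  by rewrite -!mul_prod_seq; apply: leq_prod_seq => q /C_le; nia.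
have le_exp : p.+1 ^ size B * p ^ size C <= p ^ size B * p.+1 ^ size C.
  rewrite -(subnKC szBC) !expnD mulnCA !leq_mul2l; apply/orP; right; apply/orP; right.
  by case: (_ - _) => // e; rewrite leq_exp2r.
set RB := \prod_(q <- B) q in leB *; set RC := \prod_(q <- C) q in leC *.
set FB := \prod_(q <- B) q.-1 in leB *; set FC := \prod_(q <- C) q.-1 in leC *.
have pos : 0 < p ^ size B * p.+1 ^ size C by rewrite muln_gt0 !expn_gt0 p_gt0.
rewrite -(leq_pmul2r pos).
apply: (@leq_trans (RC * FB * (p.+1 ^ size B * p ^ size C))); last first.
  by rewrite leq_mul2l le_exp orbT.
by have := leq_mul leB leC; rewrite !mulnA; lia.
Qed.

Lemma totient_primorial_dichotomy (p y : nat) : 0 < p -> 0 < y ->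
  y * totient (primorial p) <= primorial p * totient y
    \/ p * totient (primorial p) <= totient y.
Proof.
move=> p_gt0 y_gt0.
(* The primes of [y] are [A] and [B] together, those up to [p] are [A] and [C]; the factors over [A]
   cancel. *)
pose A := [seq q <- primes y | q <= p]; pose B := [seq q <- primes y | ~~ (q <= p)].
pose C := [seq q <- primes_upto p | ~~ (q %| y)].
have splity F : \prod_(q <- primes y) F q = (\prod_(q <- A) F q) * \prod_(q <- B) F q.
  by rewrite !big_filter (bigID (fun q => q <= p)).
have splitP F : \prod_(q <- primes_upto p) F q
    = (\prod_(q <- A) F q) * \prod_(q <- C) F q.
  rewrite (bigID (fun q => q %| y)) /= [in RHS]/C big_filter; congr (_ * _).
  rewrite -(big_filter (primes_upto p)); apply: perm_big; apply: uniq_perm.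
  - by rewrite filter_uniq ?primes_upto_uniq.
  - by rewrite filter_uniq ?primes_uniq.
  move=> q; rewrite mem_filter mem_primes_upto mem_filter mem_primes y_gt0 /=.
  by case: (prime q); case: (q %| y); case: (q <= p).
have B_gt : {in B, forall q, p < q}.
  by move=> q; rewrite mem_filter -ltnNge => /andP[].
have C_le : {in C, forall q, 0 < q <= p}.
  by move=> q; rewrite mem_filter mem_primes_upto => /and3P[_ /prime_gt0-> ->].
have phi_y := totientE y_gt0; have def_y := radical_cofactor _ y_gt0.
rewrite big_split /= in phi_y.
rewrite totient_primorial phi_y [X in X * _]def_y /primorial.
set e := \prod_(q <- primes y) q ^ _; rewrite !splity !splitP.
have e_gt0 : 0 < e.
  by apply: prod_gt0_seq => q; rewrite mem_primes expn_gt0 => /and3P[/prime_gt0->].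
have [szBC|szCB] := leqP (size B) (size C); [left|right].
  have := prod_ratio_exchange _ _ _ p_gt0 B_gt C_le szBC.
  set RA := \prod_(q <- A) q; set FA := \prod_(q <- A) q.-1.
  by move/(leq_mul (leqnn (e * RA * FA))); rewrite !mulnA; lia.
(* Here [B] has at least one more element than [C], and this yields the extra factor [p]. *)
have leB : p ^ size B <= \prod_(q <- B) q.-1.
  by rewrite -prod_const_seq; apply: leq_prod_seq => q /B_gt; lia.
have leC : \prod_(q <- C) q.-1 <= p ^ size C.
  by rewrite -prod_const_seq; apply: leq_prod_seq => q /C_le; lia.
have le_exp : p * p ^ size C <= p ^ size B by rewrite -expnS leq_pexp2l.
set FA := \prod_(q <- A) q.-1.
rewrite mulnCA -mulnA leq_mul2l; apply/orP; right.
apply: leq_trans (_ : p * p ^ size C <= _); first by rewrite leq_mul2l leC orbT.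
by apply: leq_trans le_exp (leq_trans leB _); rewrite leq_pmulr.
Qed.

(** * Membership in [N1] *)

(** Any [m] that witnesses [N1 x] may be replaced by [totient x], which eliminates [m]. *)
Lemma N1P (x : nat) :
  N1 x <-> 0 < x /\ forall y, x < y -> totient x < totient y.
Proof.
split=> [[m _ [x_gt0 phi_x max_x]] | [x_gt0 lt_x]].
  split=> // y lt_xy; rewrite ltnNge; apply/negP => le_yx.
  have := max_x y (ltn_trans x_gt0 lt_xy) (leq_trans le_yx phi_x).
  by rewrite leqNgt lt_xy.
exists (totient x); first by exists x.
by split=> // y _ le_yx; rewrite leqNgt; apply/negP => /lt_x; rewrite ltnNge le_yx.
Qed.

Lemma N1_mul_primorial (k p : nat) : 0 < k < p -> N1 (k * primorial p).
Proof.
case/andP=> k_gt0 lt_kp; have P_gt0 := primorial_gt0 p.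
have phiP_gt0 : 0 < totient (primorial p) by rewrite totient_gt0.
apply/N1P; split=> [|y lt_y]; first by rewrite muln_gt0 k_gt0.
apply: leq_ltn_trans (totient_mul_leq _ _ P_gt0) _.
(* Both alternatives give [k * totient (primorial p) < totient y]: the first by
   [k * primorial p < y], the second by [k < p]. *)
have [||le_y|le_y] := totient_primorial_dichotomy p y; [by lia | by lia | nia | nia].
Qed.

(** The number [(d %/ q).+1 * q * (n %/ d)] exceeds [n], so its totient does too; [q] is coprime to
    [n %/ d] and contributes [q.-1]. *)
Lemma N1_totient_exchange (n q d : nat) :
  N1 n -> prime q -> ~~ (q %| n) -> d %| n ->
  totient n < (d %/ q).+1 * q.-1 * totient (n %/ d).
Proof.
move=> /N1P[n_gt0 lt_n] pr_q q_n d_n.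
have q_gt0 := prime_gt0 pr_q; have d_gt0 := dvdn_gt0 n_gt0 d_n.
have a_gt0 : 0 < n %/ d by rewrite divn_gt0 // dvdn_leq.
have q_a : ~~ (q %| n %/ d).
  by apply: contra q_n => q_a; rewrite -(divnK d_n) dvdn_mulr.
rewrite -mulnA -totient_mul_prime_ndvd //.
apply: leq_trans (totient_mul_leq _ _ _); last by rewrite muln_gt0 q_gt0.
apply: lt_n; rewrite mulnA -{1}(divnK d_n) mulnC ltn_mul2r a_gt0.
exact: ltn_ceil.
Qed.

(* The two exchanges replace a prime [p], respectively a power [p ^ j] with
   [p ^ j.+1 %| n], by the least larger multiple of [q]. *)
Lemma N1_coprime_pfactor_bound (n q p : nat) :
  N1 n -> prime q -> ~~ (q %| n) -> p \in primes n ->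
  p ^ logn p n <= q ^ 2 * q ^ 2.
Proof.
move=> N1n pr_q q_n; rewrite mem_primes => /and3P[pr_p n_gt0 p_n].
have q_gt1 := prime_gt1 pr_q; have p_gt1 := prime_gt1 pr_p.
have ceil d : (d %/ q).+1 * q <= d + q by rewrite mulSn addnC leq_add2r leq_divM.
have small_p : p <= q ^ 2.
  have a_gt0 : 0 < n %/ p by rewrite divn_gt0 1?dvdn_leq // ltnW.
  have := N1_totient_exchange _ _ _ N1n pr_q q_n p_n.
  have := leq_totient_mul_prime _ _ pr_p a_gt0; rewrite [p * _]mulnC divnK //.
  move=> le_phi /(leq_ltn_trans le_phi); rewrite ltn_mul2r => /andP[_].
  (* With [c = (p %/ q).+1], the bounds [p.-1 < c * q.-1] and [c * q <= p + q] force [c <= q]. *)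
  by have := ceil p; rewrite -mulnn; nia.
have e_gt0 : 0 < logn p n by rewrite logn_gt0 mem_primes pr_p n_gt0.
move def_e: (logn p n) e_gt0 => [|j] // _.
have pj_n : p ^ j.+1 %| n by rewrite pfactor_dvdn // def_e.
have d_n : p ^ j %| n by apply: dvdn_trans pj_n; rewrite dvdn_exp2l.
have pj_gt0 : 0 < p ^ j by rewrite expn_gt0 ltnW.
have a_gt0 : 0 < n %/ p ^ j by rewrite divn_gt0 // dvdn_leq.
(* As [p] survives in the cofactor, removing [p ^ j] divides the totient by exactly [p ^ j]. *)
have p_a : p %| n %/ p ^ j by rewrite dvdn_divRL // -expnS.
rewrite expnS leq_mul //.
have := N1_totient_exchange _ _ _ N1n pr_q q_n d_n.
rewrite -{1}(divnK d_n) [_ * p ^ j]mulnC totient_mul_expn // ltn_mul2r => /andP[_].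
by have := ceil (p ^ j); rewrite -mulnn; nia.
Qed.

Lemma prime_dvd_large_N1 (q : nat) :
  prime q -> exists M, forall n, N1 n -> M < n -> q %| n.
Proof.
move=> pr_q; pose b := q ^ 2 * q ^ 2; exists (b ^ b.+1) => n N1n.
apply: contraTT => q_n; rewrite -leqNgt.
have n_gt0 : 0 < n by case/N1P: N1n.
have b_gt0 : 0 < b by rewrite muln_gt0 expn_gt0 prime_gt0.
have bound := N1_coprime_pfactor_bound _ _ _ N1n pr_q q_n.
rewrite [leqLHS](prod_primes_logn _ n_gt0).
apply: leq_trans (leq_prod_seq _ _ _ bound) _.
(* All prime powers in [n] are at most [b], hence so are its primes, and there are at most [b.+1] of
   them. *)
rewrite prod_const_seq leq_pexp2l // -(size_iota 0 b.+1).
apply: uniq_leq_size (primes_uniq n) _ => p p_n; rewrite mem_iota /= ltnS.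
apply: leq_trans (bound _ p_n); rewrite -{1}[p]expn1 leq_pexp2l //.
  by move: p_n; rewrite mem_primes => /and3P[/prime_gt0].
by rewrite logn_gt0.
Qed.

(** * Combinatorial structure of [N1] and [calX] *)

Lemma N1_mul_thick (F : seq nat) : {in F, forall f, 0 < f} ->
  exists2 x, 0 < x & {in F, forall f, N1 (f * x)}.
Proof.
move=> F_gt0; exists (primorial (\max_(f <- F) f).+1) => [|f f_F].
  exact: primorial_gt0.
apply: N1_mul_primorial; rewrite F_gt0 // ltnS.
exact: leq_max_seq.
Qed.

Lemma N1_mul_piecewise_syndetic : piecewise_syndetic muln N1.
Proof.
exists [:: 1]; split=> // [t|F _ F_gt0]; first by rewrite inE => /eqP->.
have [x x_gt0 N1x] := N1_mul_thick _ F_gt0; exists x => // f f_F.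
exists 1; first exact: mem_head.
by split; [rewrite muln_gt0 F_gt0 | rewrite mul1n; apply: N1x].
Qed.

(** Let the prime [q] exceed every shift in [S]. Some [f] among [q] consecutive integers makes [q]
    divide [f + x]; as [q] also divides the large element [t + (f + x)] of [N1], it divides
    [t < q]. *)
Lemma N1_not_add_piecewise_syndetic : ~ piecewise_syndetic addn N1.
Proof.
case=> S [S_n0 S_gt0 thickS].
have [q max_lt pr_q] := prime_above (\max_(t <- S) t).
have q_gt0 := prime_gt0 pr_q.
have [M dvd_q] := prime_dvd_large_N1 _ pr_q.
have [||x x_gt0 inx] := thickS (iota M.+1 q).
- by rewrite -size_eq0 size_iota -lt0n.
- by move=> f; rewrite mem_iota => /andP[/(leq_ltn_trans (leq0n M))].
(* The outer reduction covers the case where [q] already divides [x + M.+1]. *)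
pose f := M.+1 + (q - (x + M.+1) %% q) %% q.
have f_in : f \in iota M.+1 q by rewrite mem_iota leq_addr ltn_add2l ltn_pmod.
have q_fx : q %| f + x.
  rewrite /dvdn /f addnAC [M.+1 + x]addnC modnDmr -modnDml subnKC ?modnn //.
  by rewrite ltnW ?ltn_pmod.
have [t t_S [_ /dvd_q dvd_tfx]] := inx _ f_in.
have : q %| t + (f + x) by apply: dvd_tfx; rewrite /f; lia.
rewrite dvdn_addl // gtnNdvd ?S_gt0 //.
exact: leq_ltn_trans (leq_max_seq _ _ t_S) max_lt.
Qed.

Lemma N1_additive_IP0 : additive_IP0 N1.
Proof.
(* For a constant sequence the sum over [F] is [size F] times the primorial, with
   [0 < size F <= r]. *)
move=> r r_gt0; exists (fun=> primorial r.+1) => [_|s [F [F_n0 uF ->]]].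
  exact: primorial_gt0.
rewrite big_const_seq count_predT iter_addn_0 mulnC; apply: N1_mul_primorial.
rewrite lt0n size_eq0 F_n0 ltnS; rewrite -(card_uniqP uF).
by rewrite (leq_trans (max_card _)) ?card_ord.
Qed.

(* Each term is the primorial of a number exceeding the product of all the
   previous terms. *)
Fixpoint fast_primorials (n : nat) : seq nat :=
  if n is m.+1 then
    let s := fast_primorials m in
    rcons s (primorial (\prod_(x <- s) x).+1)
  else [::].

Definition fast_primorial (n : nat) : nat :=
  primorial (\prod_(x <- fast_primorials n) x).+1.

Lemma prod_fast_primorials (n : nat) :
  \prod_(x <- fast_primorials n) x = \prod_(i < n) fast_primorial i.
Proof.
elim: n => [|n IHn] /=; first by rewrite big_nil big_ord0.
by rewrite -cats1 big_cat big_seq1 big_ord_recr /= -IHn.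
Qed.

Lemma N1_multiplicative_IP : multiplicative_IP N1.
Proof.
have pos n : 0 < fast_primorial n by apply: primorial_gt0.
exists fast_primorial => // s [F [F_n0 uF ->]] {s}.
pose n := \max_(j <- F) j.
have n_F : n \in F by apply: max_seq_mem.
(* The term of largest index supplies the primorial; the others multiply to a divisor of the product
   of all earlier terms. *)
rewrite (big_rem n) //= mulnC; apply: N1_mul_primorial.
rewrite prodn_gt0 // ltnS prod_fast_primorials.
rewrite -(big_mkord xpredT fast_primorial).
apply: dvdn_leq; first by rewrite prodn_gt0.
have sub : {subset rem n F <= index_iota 0 n}.
  move=> i; rewrite mem_rem_uniq // inE mem_index_iota /= => /andP[ne_in i_F].
  by rewrite ltn_neqAle ne_in leq_max_seq.
have uR : uniq (rem n F) by rewrite rem_uniq.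
rewrite [X in _ %| X](bigID (fun i => i \in rem n F)) /=.
rewrite -(big_filter (index_iota 0 n) (fun i => i \in rem n F)).
apply: dvdn_mulr; rewrite (perm_big [seq i <- index_iota 0 n | i \in rem n F]) //.
rewrite perm_sym.
apply: uniq_perm => //; first by rewrite filter_uniq ?iota_uniq.
by move=> i; rewrite mem_filter; apply: andb_idr; apply: sub.
Qed.

(** A prime [q > x 0] divides every large finite sum, in particular [t] and [x 0 + t], hence also
    [x 0]. *)
Lemma N1_not_additive_IP : ~ additive_IP N1.
Proof.
case=> x x_gt0 inN1.
have [q lt_q pr_q] := prime_above (x 0).
have [M dvd_q] := prime_dvd_large_N1 _ pr_q.
pose t := \sum_(j <- iota 1 M.+1) x j.
have t_large : M < t.
  rewrite -[M.+1](size_iota 1) -sum1_size; apply: leq_sum => j _; exact: x_gt0.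
have q_t : q %| t.
  by apply: dvd_q => //; apply: inN1; exists (iota 1 M.+1); rewrite iota_uniq.
have : q %| x 0 + t.
  apply: dvd_q; last by rewrite ltn_addl.
  apply: inN1; exists (iota 0 M.+2); split; rewrite ?iota_uniq //.
  by rewrite [iota 0 _]/= big_cons.
by rewrite dvdn_addl // gtnNdvd.
Qed.

(** For [n > 1] the radical is at least 2, so the quotient [k] is at most half of [n], hence below
    [p]; for [n = 1] it is 1. *)
Lemma calX_mul_primorial (x : nat) :
  calX x -> exists k p, [/\ 0 < k < p, prime p & x = k * primorial p].
Proof.
case=> n [p [n_gt0 pr_p lt_n ->]]; exists (n %/ \prod_(q <- primes n) q), p.
rewrite /X_ primorialE; split=> //.
have rad_gt0 : 0 < \prod_(q <- primes n) q.
  by apply: prod_gt0_seq => q; rewrite mem_primes => /and3P[/prime_gt0].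
have rad_n : \prod_(q <- primes n) q %| n.
  by rewrite [X in _ %| X](radical_cofactor _ n_gt0) dvdn_mull.
rewrite divn_gt0 // dvdn_leq //=.
have [n_le1|n_gt1] := leqP n 1.
  by apply: leq_ltn_trans (leq_div _ _) (leq_ltn_trans n_le1 (prime_gt1 pr_p)).
have rad_gt1 : 1 < \prod_(q <- primes n) q.
  apply: leq_trans (prime_gt1 (pdiv_prime n_gt1)) (dvdn_leq rad_gt0 _).
  rewrite (big_rem (pdiv n)) ?dvdn_mulr //=.
  by rewrite mem_primes pdiv_prime ?n_gt0 ?pdiv_dvd.
rewrite ltn_divLR //; apply: leq_trans lt_n _.
by rewrite mulnC leq_mul2l rad_gt1 orbT.
Qed.

Lemma calX_no_sum_product :
  ~ (exists x y, [/\ 0 < x, 0 < y, calX (x + y) & calX (x * y)]).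
Proof.
case=> x [y [x_gt0 y_gt0 /calX_mul_primorial[k [p [/andP[k_gt0 lt_kp] pr_p sum_xy]]]]].
case/calX_mul_primorial=> l [r [/andP[l_gt0 lt_lr] pr_r prod_xy]].
(* Such a prime divides the product, hence one of [x] and [y], and through the sum the other. *)
have common q : prime q -> q <= p -> q <= r -> (q %| x) && (q %| y).
  move=> pr_q le_qp le_qr.
  have q_sum : q %| x + y by rewrite sum_xy dvdn_mull ?prime_dvd_primorial.
  have : q %| x * y by rewrite prod_xy dvdn_mull ?prime_dvd_primorial.
  rewrite Euclid_dvdM // => /orP[] q_dvd; rewrite q_dvd.
    by rewrite -(dvdn_addr _ q_dvd).
  by rewrite -(dvdn_addl _ q_dvd) q_sum.
have [le_rp|lt_pr] := leqP r p.
  have dvdr z : z \in [:: x; y] -> primorial r %| z.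
    move=> z_xy; apply: primorial_dvd => q pr_q le_qr.
    have /andP[q_x q_y] := common q pr_q (leq_trans le_qr le_rp) le_qr.
    by move: z_xy; rewrite !inE => /orP[] /eqP->.
  have : primorial r * primorial r %| l * primorial r.
    by rewrite -prod_xy dvdn_mul ?dvdr ?inE ?eqxx ?orbT.
  rewrite dvdn_pmul2r ?primorial_gt0 // => /(dvdn_leq l_gt0).
  have r_P : r %| primorial r by rewrite prime_dvd_primorial.
  by rewrite leqNgt (leq_trans lt_lr) // dvdn_leq ?primorial_gt0.
have dvdp z : z \in [:: x; y] -> primorial p %| z.
  move=> z_xy; apply: primorial_dvd => q pr_q le_qp.
  have /andP[q_x q_y] := common q pr_q le_qp (leq_trans le_qp (ltnW lt_pr)).
  by move: z_xy; rewrite !inE => /orP[] /eqP->.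
have /dvdnP[x' def_x] : primorial p %| x by rewrite dvdp ?inE ?eqxx.
have /dvdnP[y' def_y] : primorial p %| y by rewrite dvdp ?inE ?eqxx ?orbT.
have r_P : (r %| primorial p) = false by rewrite prime_dvd_primorial // leqNgt lt_pr.
have : r %| x * y by rewrite prod_xy dvdn_mull ?prime_dvd_primorial.
rewrite Euclid_dvdM // def_x def_y !Euclid_dvdM // r_P !orbF.
have sum' : x' + y' = k.
  by apply/eqP; rewrite -(eqn_pmul2r (primorial_gt0 p)) mulnDl -def_x -def_y sum_xy.
have x'_gt0 : 0 < x' by move: x_gt0; rewrite def_x muln_gt0 => /andP[].
have y'_gt0 : 0 < y' by move: y_gt0; rewrite def_y muln_gt0 => /andP[].
(* Both [x'] and [y'] are positive and less than [k < p < r]. *)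
by rewrite !gtnNdvd //; lia.
Qed.

Lemma N1_long_AP : contains_arbitrarily_long_AP N1.
Proof.
(* With equal start and difference the terms are the multiples by [i.+1 < k.+2]. *)
move=> k; exists (primorial k.+2), (primorial k.+2).
split=> [||i lt_ik]; rewrite ?primorial_gt0 //.
by rewrite -mulSn; apply: N1_mul_primorial; lia.
Qed.

Lemma N1_long_GP : contains_arbitrarily_long_GP N1.
Proof.
move=> k; exists (primorial (2 ^ k)), 2.
split=> [||i lt_ik]; rewrite ?primorial_gt0 // mulnC.
by apply: N1_mul_primorial; rewrite expn_gt0 ltn_exp2l.
Qed.

Theorem theorem5 :
  [/\ piecewise_syndetic muln N1 /\ ~ piecewise_syndetic addn N1,
      [/\ additive_IP0 N1, multiplicative_IP N1 & ~ additive_IP N1],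
      ~ (exists x y, [/\ 0 < x, 0 < y, calX (x + y) & calX (x * y)])
    & contains_arbitrarily_long_AP N1 /\ contains_arbitrarily_long_GP N1].
Proof.
split.
- by split; [apply: N1_mul_piecewise_syndetic | apply: N1_not_add_piecewise_syndetic].
- split; [exact: N1_additive_IP0 | exact: N1_multiplicative_IP |].
  exact: N1_not_additive_IP.
- exact: calX_no_sum_product.
- by split; [apply: N1_long_AP | apply: N1_long_GP].
Qed.
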